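(* Let $\mathcal{H}=\mathcal{H}(\Omega)$ be a reproducing kernel Hilbert space, let $\sigma$ be a symmetric mean with interpolation path $\sigma_t$, $t\in[0,1]$, and let $A\in B(\mathcal{H})$. If $\sigma_t\le\nabla_t$, then for $p\ge2$: (i) $\|A\|_{ber_{\sigma_t}}^p\le \mathrm{ber}\left(t|A^*|^p+(1-t)|A|^p\right)$; (ii) $\mathrm{ber}^p(A)\le\min_{t\in[0,1]}\mathrm{ber}\left(t|A|^p+(1-t)|A^*|^p\right)$.
   Context: A reproducing kernel Hilbert space $\mathcal{H}=\mathcal{H}(\Omega)$ on a nonempty set $\Omega$ is a Hilbert space of complex-valued functions on $\Omega$ whose point evaluations are bounded; $k_\lambda\in\mathcal H$ is the reproducing kernel at $\lambda\in\Omega$ (so $f(\lambda)=\langle f,k_\lambda\rangle$ for all $f\in\mathcal H$), and $\hat k_\lambda=k_\lambda/\|k_\lambda\|$ is the normalized reproducing kernel (implicitly $k_\lambda\ne 0$ for all $\lambda$). $B(\mathcal H)$ is the algebra of bounded linear operators on $\mathcal H$; $|A|=(A^*A)^{1/2}$. A mean is a function $\sigma:[0,\infty)\times[0,\infty)\to[0,\infty)$, written $a\,\sigma\, b=\sigma(a,b)$, such that: $\sigma(a,b)\ge 0$; $a\le b$ implies $a\le a\,\sigma\, b\le b$; $\sigma$ is increasing in both variables; $\sigma(\alpha a,\alpha b)=\alpha\,\sigma(a,b)$ for $\alpha>0$; $\sigma$ is continuous. It is symmetric if $a\,\sigma\, b=b\,\sigma\, a$ for all $a,b$. An interpolation path for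 a symmetric mean $\sigma$ is a family of means $\sigma_t$, $t\in[0,1]$, such that: (i) $a\,\sigma_0\, b=b$, $a\,\sigma_1\, b=a$, $a\,\sigma_{1/2}\, b=a\,\sigma\, b$ for all $a,b\ge0$; (ii) $(a\,\sigma_t\, b)\,\sigma\,(a\,\sigma_s\, b)=a\,\sigma_{(t+s)/2}\, b$ for all $s,t\in[0,1]$; (iii) each $\sigma_t$ is increasing in each component. The arithmetic mean $a\nabla b=(a+b)/2$ has interpolation path $a\nabla_t b=ta+(1-t)b$; $\sigma_t\le\nabla_t$ means $a\,\sigma_t\,b\le ta+(1-t)b$ for all $a,b\ge0$. For $A\in B(\mathcal H)$, $t\in[0,1]$ and $p\ge1$, the $\sigma_t$-Berezin norm is $\|A\|_{ber_{\sigma_t}}=\sup_{\lambda,\mu\in\Omega}\left(|\langle A\hat k_\lambda,\hat k_\mu\rangle|^p\,\sigma_t\,|\langle A^*\hat k_\lambda,\hat k_\mu\rangle|^p\right)^{1/p}$ (the $p$ here is the $p$ of the claim). The Berezin radius is $\mathrm{ber}(A)=\sup_{\lambda\in\Omega}|\langle A\hat k_\lambda,\hat k_\lambda\rangle|$, and $\mathrm{ber}^p(A)=(\mathrm{ber}(A))^p$. *)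

(* Defs.v *)
From HB Require Import structures.
From mathcomp Require Import all_boot all_order all_algebra.
From mathcomp Require Import all_classical all_reals all_analysis.
From mathcomp Require Import complex.

Set Implicit Arguments.
Unset Strict Implicit.
Unset Printing Implicit Defensive.

Import Order.TTheory GRing.Theory Num.Theory.
Import numFieldNormedType.Exports.

Local Open Scope classical_set_scope.
Local Open Scope ring_scope.
Local Open Scope complex_scope.

(* The inner product is linear in its first argument and conjugate-linear in
   the second; completeness is that of the underlying normed module. *)
HB.mixin Record isHilbert (R : realType) H of CompleteNormedModule R[i] H := {
  inner : H -> H -> R[i];
  inner_linearl : forall (y : H) (a : R[i]) (u v : H),
    inner (a *: u + v) y = a * inner u y + inner v y;
  inner_conj : forall x y : H, inner y x = (inner x y)^*;
  inner_norm : forall x : H, inner x x = `|x| ^+ 2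
}.

#[short(type="hilbertType")]
HB.structure Definition Hilbert (R : realType) :=
  {H of isHilbert R H & CompleteNormedModule R[i] H}.

(* A reproducing kernel Hilbert space on Omega: [funof] is the inclusion of H
   into the space of all functions Omega -> R[i]. *)
HB.mixin Record isRKHS (R : realType) (Omega : Type) H of Hilbert R H := {
  funof : H -> Omega -> R[i];
  funof_linear : forall (a : R[i]) (f g : H) (lam : Omega),
    funof (a *: f + g) lam = a * funof f lam + funof g lam;
  funof_inj : injective funof;
  funof_bounded : forall lam : Omega,
    exists M : R[i], forall f : H, `|funof f lam| <= M * `|f|
}.

#[short(type="rkhsType")]
HB.structure Definition RKHS (R : realType) (Omega : Type) :=
  {H of isRKHS R Omega H & Hilbert R H}.

Section Operators.
Variables (R : realType) (H : hilbertType R).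
Implicit Types (A B S T : H -> H).

Definition bounded_operator A : Prop :=
  linear A /\ exists M : R[i], forall x : H, `|A x| <= M * `|x|.

(* In R[i], [0 <= z] means that z is real and nonnegative. *)
Definition positive_operator A : Prop := forall x : H, 0 <= inner (A x) x.

Definition adjoint A : H -> H :=
  get [set B | forall x y : H, inner (A x) y = inner x (B y)].

Definition op_abs A : H -> H :=
  get [set S | [/\ bounded_operator S, positive_operator S &
                   S \o S = adjoint A \o A]].

Definition op_poly (q : {poly R}) T : H -> H :=
  fun x => \sum_(i < size q) (q`_i)%:C *: iter i T x.

(* Continuous functional calculus of a positive operator T: f(T) is the
   operator to which q(T) is close in operator norm whenever the polynomial q
   is uniformly close to f on an interval [0, M] with ||T|| <= M (such an
   interval contains the spectrum of T). By the Weierstrass theorem it is the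
   limit of the q_n(T) for any polynomials q_n converging uniformly to f. *)
Definition op_fun (f : R -> R) T : H -> H :=
  get [set S | bounded_operator S /\
    forall (M : R) (q : {poly R}) (e : R),
      (forall x : H, `|T x| <= M%:C * `|x|) ->
      (forall s : R, 0 <= s <= M -> `|q.[s] - f s| <= e) ->
      forall x : H, `|op_poly q T x - S x| <= e%:C * `|x|].

Definition op_pow T (p : R) : H -> H := op_fun (fun s => s `^ p) T.

End Operators.

Section Means.
Variable R : realType.
Implicit Type m : R -> R -> R.

(* A function on [0, oo) x [0, oo) is represented by a function on R x R of
   which only the values at nonnegative arguments are constrained. *)
Record is_mean m : Prop := IsMean {
  mean_ge0 : forall a b, 0 <= a -> 0 <= b -> 0 <= m a b;
  mean_between : forall a b, 0 <= a -> a <= b -> a <= m a b <= b;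
  mean_incr : forall a a' b b', 0 <= a -> 0 <= b -> a <= a' -> b <= b' ->
    m a b <= m a' b';
  mean_homog : forall alpha a b, 0 < alpha -> 0 <= a -> 0 <= b ->
    m (alpha * a) (alpha * b) = alpha * m a b;
  mean_continuous : {within [set z : R * R | 0 <= z.1 /\ 0 <= z.2],
    continuous (fun z : R * R => m z.1 z.2)}
}.

Definition symmetric_mean m : Prop :=
  is_mean m /\ forall a b, 0 <= a -> 0 <= b -> m a b = m b a.

Record interpolation_path (sigma : R -> R -> R) (sigma_ : R -> R -> R -> R) :
    Prop := InterpolationPath {
  path_mean : forall t, 0 <= t <= 1 -> is_mean (sigma_ t);
  path_0 : forall a b, 0 <= a -> 0 <= b -> sigma_ 0 a b = b;
  path_1 : forall a b, 0 <= a -> 0 <= b -> sigma_ 1 a b = a;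
  path_half : forall a b, 0 <= a -> 0 <= b -> sigma_ 2^-1 a b = sigma a b;
  path_mid : forall s t a b, 0 <= s <= 1 -> 0 <= t <= 1 -> 0 <= a -> 0 <= b ->
    sigma (sigma_ t a b) (sigma_ s a b) = sigma_ ((t + s) / 2) a b;
  path_incr : forall t a a' b b', 0 <= t <= 1 ->
    0 <= a -> 0 <= b -> a <= a' -> b <= b' -> sigma_ t a b <= sigma_ t a' b'
}.

Definition nabla (t a b : R) : R := t * a + (1 - t) * b.

Definition mean_le m1 m2 : Prop :=
  forall a b, 0 <= a -> 0 <= b -> m1 a b <= m2 a b.

End Means.

Section Berezin.
Variables (R : realType) (Omega : Type) (H : rkhsType R Omega).
Implicit Type A : H -> H.

Definition rkernel (lam : Omega) : H :=
  get [set k | forall f : H, funof f lam = inner f k].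

Definition nkernel (lam : Omega) : H := `|rkernel lam|^-1 *: rkernel lam.

(* |<A k^_lam, k^_mu>| as an element of R ([normc] is the modulus) *)
Definition berezin_abs A (lam mu : Omega) : R :=
  ComplexField.Normc.normc (inner (A (nkernel lam)) (nkernel mu)).

Definition ber A : R := sup [set berezin_abs A lam lam | lam in [set: Omega]].

Definition ber_norm (m : R -> R -> R) (p : R) A : R :=
  sup [set (m (berezin_abs A z.1 z.2 `^ p)
              (berezin_abs (adjoint A) z.1 z.2 `^ p)) `^ p^-1
      | z in [set: Omega * Omega]].

End Berezin.

(* Main.v *)
Require Import Defs.
From HB Require Import structures.
From mathcomp Require Import all_boot all_order all_algebra.
From mathcomp Require Import all_classical all_reals all_analysis.
From mathcomp Require Import complex.
From mathcomp Require Import ring lra.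

Set Implicit Arguments.
Unset Strict Implicit.
Unset Printing Implicit Defensive.

Import Order.TTheory GRing.Theory Num.Theory.
Import numFieldNormedType.Exports.

Local Open Scope classical_set_scope.
Local Open Scope ring_scope.
Local Open Scope complex_scope.

(** For unit vectors [x] and [y] one has [|<A x, y>| <= |A^* y|] and
    [|<A^* x, y>| <= |A y|]. Since the mean is below the weighted arithmetic one,
    the first bound reduces to
    [|A y|^p <= < |A|^p y, y>] and its analogue for the adjoint (lemma
    [nrm_powR_le_op_abs]): the weighted sum of the two right-hand sides is a
    diagonal value of [t |A^*|^p + (1 - t) |A|^p], hence at most its Berezin
    radius. For the second bound, [|<A y, y>|] is at most both [|A y|] and
    [|A^* y|], so its [p]-th power is at most every convex combination of their
    [p]-th powers; the minimum is attained because the Berezin radius is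
    Lipschitz along a segment of operators (lemma [ber_combination_min]).

    The inequality [|A y|^p <= < |A|^p y, y>] is McCarthy's. As
    [| |A| y | = |A y|], it says that [< T^p y, y> >= |T y|^p] for [T = |A|], and
    it follows by applying to [T] the fact that [s^p] lies above the parabola
    which is tangent to it, as a function of [s^2], at [s = |T y|].

    The operators in the statement are chosen by a description, so they have to
    be shown to exist. The adjoint comes from the Riesz representation theorem,
    obtained by minimizing [|x|^2 - 2 Re (phi x)]. The operators [|A|] and
    [|A|^p] come from the continuous functional calculus of a positive operator
    [T] with [|T| <= M] (lemma [op_funP]), which rests on two facts. Every
    function with a suitable modulus of continuity is a uniform limit of
    polynomials on [[0, M]], by Bernstein's proof. And if a polynomial [q] is
    nonnegative on [[0, M]], then [q(T)] is positive: [q] lies in the cone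
    generated by squares, ['X] and [M - 'X] (lemma [interval_coneP]), and such a
    representation makes positivity of [q(T)] evident. Applied to [e^2 - q^2],
    this gives the norm bound [|q(T)| <= sup |q|] without any spectral theory. *)

(** * The real inner product and norm of a complex Hilbert space *)

Section RealParts.
Variables (R : realType) (H : hilbertType R).
Implicit Types (x y z : H) (a : R[i]) (r : R).

Definition nrm x : R := complex.Re `|x|.
Definition rinner x y : R := complex.Re (inner x y).

Lemma nrmE x : `|x| = (nrm x)%:C.
Proof. by rewrite /nrm RRe_real // normr_real. Qed.

Lemma nrm_ge0 x : 0 <= nrm x.
Proof. by rewrite -lecR -nrmE normr_ge0. Qed.

Lemma nrm_eq0 x : (nrm x == 0) = (x == 0).
Proof.
rewrite -[x == 0]normr_eq0 nrmE; apply/eqP/eqP => [->|]//.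
by move/complexI.
Qed.

Lemma nrm0 : nrm 0 = 0. Proof. by apply/eqP; rewrite nrm_eq0. Qed.

Lemma nrmN x : nrm (- x) = nrm x.
Proof. by rewrite /nrm normrN. Qed.

Lemma ler_nrmD x y : nrm (x + y) <= nrm x + nrm y.
Proof.
rewrite -lecR -nrmE.
have -> : (nrm x + nrm y)%:C = `|x| + `|y| by rewrite !nrmE -rmorphD.
exact: ler_normD.
Qed.

Lemma nrmB x y : nrm (x - y) = nrm (y - x).
Proof. by rewrite -nrmN opprB. Qed.

Lemma ler_nrmB z x y : nrm (x - y) <= nrm (x - z) + nrm (z - y).
Proof. by have := ler_nrmD (x - z) (z - y); rewrite addrA subrK. Qed.

Lemma normr_normcE a : `|a| = (ComplexField.Normc.normc a)%:C.
Proof. by []. Qed.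

Lemma normc_ge0 a : 0 <= ComplexField.Normc.normc a.
Proof. by rewrite -lecR -normr_normcE normr_ge0. Qed.

Lemma nrmZ a x : nrm (a *: x) = ComplexField.Normc.normc a * nrm x.
Proof. by apply: complexI; rewrite -nrmE normrZ nrmE normr_normcE -rmorphM. Qed.

Lemma normc_real r : ComplexField.Normc.normc r%:C = `|r|.
Proof. by rewrite /= expr0n /= addr0 sqrtr_sqr. Qed.

Lemma nrmZr r x : nrm (r%:C *: x) = `|r| * nrm x.
Proof. by rewrite nrmZ normc_real. Qed.

Lemma innerDl x y z : inner (x + y) z = inner x z + inner y z.
Proof. by have := inner_linearl z 1 x y; rewrite scale1r mul1r. Qed.

Lemma inner0l z : inner 0 z = 0.
Proof. by apply: (@addrI _ (inner 0 z)); rewrite -innerDl !addr0. Qed.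

Lemma innerZl a x z : inner (a *: x) z = a * inner x z.
Proof. by have := inner_linearl z a x 0; rewrite inner0l !addr0. Qed.

Lemma innerNl x z : inner (- x) z = - inner x z.
Proof. by rewrite -scaleN1r innerZl mulN1r. Qed.

Lemma innerBl x y z : inner (x - y) z = inner x z - inner y z.
Proof. by rewrite innerDl innerNl. Qed.

Lemma innerDr z x y : inner z (x + y) = inner z x + inner z y.
Proof. by rewrite inner_conj innerDl rmorphD /= -!inner_conj. Qed.

Lemma innerZr a z x : inner z (a *: x) = a^* * inner z x.
Proof. by rewrite inner_conj innerZl rmorphM /= -!inner_conj. Qed.

Lemma innerNr z x : inner z (- x) = - inner z x.
Proof. by rewrite inner_conj innerNl rmorphN /= -inner_conj. Qed.

Lemma innerBr z x y : inner z (x - y) = inner z x - inner z y.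
Proof. by rewrite innerDr innerNr. Qed.

Lemma ReD a b : complex.Re (a + b) = complex.Re a + complex.Re b :> R.
Proof. by case: a; case: b. Qed.
Lemma ReN a : complex.Re (- a) = - complex.Re a :> R.
Proof. by case: a. Qed.
Lemma ReZ r a : complex.Re (r%:C * a) = r * complex.Re a.
Proof. by case: a => a b /=; rewrite mul0r subr0. Qed.

Lemma rinnerC x y : rinner x y = rinner y x.
Proof. by rewrite /rinner inner_conj; case: (inner y x). Qed.

Lemma rinnerDl x y z : rinner (x + y) z = rinner x z + rinner y z.
Proof. by rewrite /rinner innerDl ReD. Qed.
Lemma rinnerNl x z : rinner (- x) z = - rinner x z.
Proof. by rewrite /rinner innerNl ReN. Qed.
Lemma rinnerBl x y z : rinner (x - y) z = rinner x z - rinner y z.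
Proof. by rewrite rinnerDl rinnerNl. Qed.
Lemma rinnerZl r x z : rinner (r%:C *: x) z = r * rinner x z.
Proof. by rewrite /rinner innerZl ReZ. Qed.
Lemma rinnerDr z x y : rinner z (x + y) = rinner z x + rinner z y.
Proof. by rewrite rinnerC rinnerDl !(rinnerC z). Qed.
Lemma rinnerNr z x : rinner z (- x) = - rinner z x.
Proof. by rewrite rinnerC rinnerNl (rinnerC z). Qed.
Lemma rinnerBr z x y : rinner z (x - y) = rinner z x - rinner z y.
Proof. by rewrite rinnerDr rinnerNr. Qed.
Lemma rinnerZr r z x : rinner z (r%:C *: x) = r * rinner z x.
Proof. by rewrite rinnerC rinnerZl (rinnerC z). Qed.

Lemma rinner_nrm x : rinner x x = nrm x ^+ 2.
Proof. by rewrite /rinner inner_norm nrmE -rmorphXn. Qed.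

Lemma sqr_nrmD x y : nrm (x + y) ^+ 2 = nrm x ^+ 2 + 2 * rinner x y + nrm y ^+ 2.
Proof.
by rewrite -!rinner_nrm !rinnerDl !rinnerDr (rinnerC y x); ring.
Qed.

(** Cauchy-Schwarz is the triangle inequality squared. *)
Lemma rinner_le x y : rinner x y <= nrm x * nrm y.
Proof.
have h := ler_nrmD x y.
have : nrm (x + y) ^+ 2 <= (nrm x + nrm y) ^+ 2.
  by rewrite ler_sqr ?nnegrE ?addr_ge0 ?nrm_ge0.
rewrite sqr_nrmD sqrrD; nra.
Qed.

Lemma normr_rinner_le x y : `|rinner x y| <= nrm x * nrm y.
Proof.
rewrite ler_norml rinner_le andbT lerNl -rinnerNl -(nrmN x); exact: rinner_le.
Qed.

Lemma Re_le_normc a : complex.Re a <= ComplexField.Normc.normc a.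
Proof.
rewrite -lecR; apply: le_trans (normc_ge_Re a).
by rewrite lecR ler_norm.
Qed.

(** Rotating [x] by a phase makes the inner product real and nonnegative. *)
Lemma normc_inner_le x y :
  ComplexField.Normc.normc (inner x y) <= nrm x * nrm y.
Proof.
set w := inner x y.
have [w0|w0] := eqVneq w 0.
  by rewrite w0 normc_real normr0 mulr_ge0 ?nrm_ge0.
set c := ComplexField.Normc.normc w.
have c0 : c != 0 by apply: contra_neq w0 => /ComplexField.Normc.eq0_normc.
set u := w^* / c%:C.
have uw : u * w = c%:C.
  rewrite /u mulrAC (mulrC _ w) -sqr_normc normr_normcE -/c expr2 mulfK //.
  by apply: contra_neq c0 => /complexI.
have u1 : ComplexField.Normc.normc u = 1.
  have := congr1 (@ComplexField.Normc.normc R) uw.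
  rewrite ComplexField.Normc.normcM -/c normc_real ger0_norm ?normc_ge0 //.
  by rewrite -[RHS]mul1r => /(mulIf c0).
have <- : rinner (u *: x) y = c by rewrite /rinner innerZl -/w uw.
by apply: le_trans (rinner_le _ _) _; rewrite nrmZ u1 mul1r.
Qed.

End RealParts.

(** * Completeness, Riesz representation and adjoints *)

Section Completeness.
Variables (R : realType).

(** Equalities of limits are proved below by letting the error bound [c / (n + 1)]
    tend to zero. *)
Lemma le0_natSinv (a c : R) : (forall n, a <= c * n.+1%:R^-1) -> a <= 0.
Proof.
move=> h; rewrite leNgt; apply/negP => a0.
have c1 : 0 < `|c| + 1 by rewrite ltr_pwDr.
have [k] := ltr_add_invr (divr_gt0 a0 c1).
rewrite add0r ltr_pdivlMr // mulrC => hk.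
move: hk (h k); set e : R := k.+1%:R^-1 => hk hc.
have e0 : 0 < e by rewrite invr_gt0.
have := ler_norm c; nra.
Qed.

Variable (H : hilbertType R).
Implicit Types (x y z : H).

(** Completeness in an explicit form: an explicit Cauchy rate is kept by the
    limit, so that all later limits come with error bounds. *)
Lemma nrm_complete (u : nat -> H) (c : R) :
  (forall m n, nrm (u m - u n) <= c * (m.+1%:R^-1 + n.+1%:R^-1)) ->
  exists z, forall n, nrm (u n - z) <= c * n.+1%:R^-1.
Proof.
move=> hu.
have c0 : 0 <= c.
  have := le_trans (nrm_ge0 _) (hu 0 0)%N; rewrite invr1; lra.
have c2 : 0 < 2 * c + 1 by lra.
have inv_le m n : (m <= n)%N -> n.+1%:R^-1 <= m.+1%:R^-1 :> R.
  by move=> mn; rewrite lef_pV2 ?posrE ?ltr0n // ler_nat ltnS.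
have uc : cvg (u @ \oo).
  apply/cauchy_cvgP/cauchy_exP => e e0.
  have eE : e = (complex.Re e)%:C by rewrite RRe_real // gtr0_real.
  have r0 : 0 < complex.Re e by rewrite -ltcR -eE.
  have [k] := ltr_add_invr (divr_gt0 r0 c2).
  rewrite add0r ltr_pdivlMr // => hk; exists (u k); exists k => // n /= kn.
  rewrite -ball_normE /= eE nrmE ltcR.
  apply: le_lt_trans (hu _ _) _; apply: le_lt_trans hk.
  have := inv_le _ _ kn; have : 0 < k.+1%:R^-1 :> R by rewrite invr_gt0.
  move: k.+1%:R^-1 n.+1%:R^-1 => a b a0 ba.
  have := ler_wpM2l c0 ba; lra.
exists (lim (u @ \oo)) => n; set z := lim _.
apply/ler_addgt0Pr => d d0.
have /cvgrPdist_lt /(_ (d / 2)%:C) : u @ \oo --> z by [].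
rewrite ltcR divr_gt0 // => /(_ isT) [k _ hk].
have [l] := ltr_add_invr (divr_gt0 d0 c2).
rewrite add0r ltr_pdivlMr // => hl.
pose m := maxn k l.
have := hk m (leq_maxl _ _); rewrite /= nrmE ltcR (nrmB z (u m)) => h1.
have h2 := hu n m; have := ler_nrmB (u m) (u n) z.
have := inv_le _ _ (leq_maxr k l : (l <= m)%N).
have : 0 < l.+1%:R^-1 :> R by rewrite invr_gt0.
move: h1 h2 hl; move: l.+1%:R^-1 m.+1%:R^-1 n.+1%:R^-1 => a b e h1 h2 hl a0 ba.
have := ler_wpM2l c0 ba; lra.
Qed.

End Completeness.

Section Riesz.
Variables (R : realType) (H : hilbertType R).
Implicit Types (x y z : H).

(** The representing vector minimizes [F x = |x|^2 - 2 Re (phi x)]. By the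
    parallelogram law a minimizing sequence is a Cauchy sequence, and the first
    variation of [F] vanishes at its limit; this is the real part of the
    identity, and its value at ['i x] is the imaginary part. *)
Lemma riesz_representation (phi : H -> R[i]) (K : R) :
  (forall a x y, phi (a *: x + y) = a * phi x + phi y) ->
  (forall x, ComplexField.Normc.normc (phi x) <= K * nrm x) ->
  exists z, forall x, phi x = inner x z.
Proof.
move=> phiL phiK.
pose f x := complex.Re (phi x).
have fD x y : f (x + y) = f x + f y.
  by rewrite /f -[x]scale1r phiL mul1r ReD scale1r.
have phi0 : phi 0 = 0.
  by have := phiL (-1) 0 0; rewrite scaler0 addr0 mulN1r addNr.
have fZ (r : R) x : f (r%:C *: x) = r * f x.
  by have := phiL r%:C x 0; rewrite !addr0 phi0 addr0 /f => ->; rewrite ReZ.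
pose F x := nrm x ^+ 2 - 2 * f x.
have Flb : lbound (range F) (- K ^+ 2).
  move=> _ [x _ <-]; rewrite /F.
  have := le_trans (Re_le_normc _) (phiK x); rewrite -/(f x).
  have := sqr_ge0 (nrm x - K); nra.
have Finf : has_inf (range F) by split; [exists (F 0), 0|exists (- K ^+ 2)].
pose d := inf (range F).
have dF x : d <= F x by apply: ge_inf; [exact: Finf.2|exists x].
have /choice[u hu] n : exists x, F x <= d + n.+1%:R^-1 ^+ 2.
  have [|_ [x _ <-] hx] := @inf_adherent _ _ (n.+1%:R^-1 ^+ 2) _ Finf.
    by rewrite exprn_gt0 // invr_gt0.
  by exists x; exact: ltW.
have [z hz] : exists z, forall n, nrm (u n - z) <= 2 * n.+1%:R^-1.
  apply: nrm_complete => m n.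
  set a : R := m.+1%:R^-1; set b : R := n.+1%:R^-1.
  have a0 : 0 < a by rewrite invr_gt0.
  have b0 : 0 < b by rewrite invr_gt0.
  rewrite -ler_sqr ?nnegrE ?nrm_ge0 //; last by lra.
  have := dF ((2^-1 : R)%:C *: (u m + u n)).
  have := hu m; have := hu n; rewrite -/a -/b /F nrmZr fZ fD ger0_norm; last by lra.
  have := sqr_nrmD (u m) (u n); have := sqr_nrmD (u m) (- u n).
  rewrite rinnerNr nrmN; nra.
have zre x : rinner z x = f x.
  suff h n : `|rinner z x - f x| <= (2 * nrm x + (1 + nrm x ^+ 2) / 2) * n.+1%:R^-1.
    by apply/eqP; rewrite -subr_eq0 -normr_le0; exact: le0_natSinv h.
  set e : R := n.+1%:R^-1.
  have e0 : 0 < e by rewrite invr_gt0.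
  (* The first variation of [F] at the almost minimizer [u n] is almost zero. *)
  have var (s : R) : s ^+ 2 = 1 ->
      - (1 + nrm x ^+ 2) / 2 * e <= s * (rinner (u n) x - f x).
    move=> s1; have := dF (u n + (s * e)%:C *: x); have := hu n.
    rewrite /F sqr_nrmD fD fZ rinnerZr nrmZr exprMn real_normK ?num_real //.
    rewrite exprMn s1 -/e => h1 h2.
    have : 0 <= e * (e * (1 + nrm x ^+ 2) + 2 * (s * (rinner (u n) x - f x))) by lra.
    rewrite pmulr_rge0 //; lra.
  have := var 1 (expr1n _ _); have := var (-1); rewrite sqrrN expr1n => /(_ erefl).
  have := normr_rinner_le (u n - z) x; rewrite rinnerBl.
  have : nrm (u n - z) * nrm x <= 2 * e * nrm x by rewrite ler_wpM2r ?nrm_ge0.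
  rewrite !ler_norml => h1 /andP[h2 h3] h4 h5; apply/andP; split; lra.
exists z => x; rewrite inner_conj.
have hre := zre x; have := zre ('i *: x).
rewrite /rinner /f in hre *; rewrite innerZr.
have -> : phi ('i *: x) = 'i * phi x.
  by have := phiL 'i x 0; rewrite !addr0 phi0 addr0.
move: hre; case: (inner z x) => a b; case: (phi x) => c e /= ->.
by rewrite !mul0r !mulN1r !mul1r !sub0r opprK => ->; rewrite opprK.
Qed.

End Riesz.

Section BoundedOperators.
Variables (R : realType) (H : hilbertType R).
Implicit Types (x y z : H) (A B : H -> H).

Lemma linD A x y : linear A -> A (x + y) = A x + A y.
Proof. by move=> hA; rewrite -[x]scale1r hA !scale1r. Qed.
Lemma lin0 A : linear A -> A 0 = 0.
Proof. by move=> hA; have := hA (-1) 0 0; rewrite scaler0 addr0 scaleN1r addNr. Qed.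
Lemma linZ A a x : linear A -> A (a *: x) = a *: A x.
Proof. by move=> hA; have := hA a x 0; rewrite !addr0 lin0 // addr0. Qed.
Lemma linB A x y : linear A -> A (x - y) = A x - A y.
Proof. by move=> hA; rewrite linD // -scaleN1r linZ // scaleN1r. Qed.

(** The constant of a bounded operator may be taken real and nonnegative. *)
Lemma bounded_operatorP A : bounded_operator A <->
  linear A /\ exists2 K : R, 0 <= K & forall x, nrm (A x) <= K * nrm x.
Proof.
split=> -[lA]; last first.
  move=> [K _ hK]; split=> //; exists K%:C => x.
  by rewrite !nrmE -rmorphM lecR.
move=> [M hM]; split=> //; exists (ComplexField.Normc.normc M).
  exact: normc_ge0.
move=> x; have := Re_le_normc (M * `|x|); have := hM x.
rewrite lecE ComplexField.Normc.normcM -/(nrm (A x)) => /andP[_ h1 h2].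
apply: le_trans h1 (le_trans h2 _).
by rewrite nrmE normc_real ger0_norm ?nrm_ge0.
Qed.

(** By Riesz, [x |-> <A x, y>] is represented by a vector, which is [A^* y]. *)
Lemma adjointP A : bounded_operator A ->
  forall x y, inner (A x) y = inner x (adjoint A y).
Proof.
move=> /bounded_operatorP[lA [K K0 hK]]; rewrite /adjoint.
suff : exists B : H -> H, forall x y, inner (A x) y = inner x (B y).
  by move=> /getPex.
suff /choice[B hB] : forall y, exists z, forall x, inner (A x) y = inner x z.
  by exists B => x y; exact: hB.
move=> y; apply: (@riesz_representation _ _ (fun x => inner (A x) y) (K * nrm y)).
  by move=> a u v; rewrite lA innerDl innerZl.
move=> x; apply: le_trans (normc_inner_le _ _) _.
by rewrite mulrAC ler_wpM2r ?nrm_ge0.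
Qed.

Lemma inner_ext x y : (forall z, inner z x = inner z y) -> x = y.
Proof.
move=> h; apply/eqP; rewrite -subr_eq0 -nrm_eq0 -sqrf_eq0.
by rewrite -rinner_nrm /rinner innerBr h subrr.
Qed.

Lemma adjoint_bounded A : bounded_operator A -> bounded_operator (adjoint A).
Proof.
move=> hA; have adj := adjointP hA; have [lA [K K0 hK]] := (bounded_operatorP _).1 hA.
apply/bounded_operatorP; split=> [a x y|].
  by apply: inner_ext => z; rewrite -adj !innerDr !innerZr !adj.
exists K => // y; have [->|n0] := eqVneq (nrm (adjoint A y)) 0.
  by rewrite mulr_ge0 ?nrm_ge0.
have np : 0 < nrm (adjoint A y) by rewrite lt_neqAle eq_sym n0 nrm_ge0.
rewrite -(ler_pM2r np) -expr2 -rinner_nrm /rinner -adj.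
apply: le_trans (rinner_le _ _) _; rewrite mulrAC ler_wpM2r ?nrm_ge0 //.
Qed.

Lemma adjointPr A : bounded_operator A ->
  forall x y, inner (adjoint A x) y = inner x (A y).
Proof. by move=> hA x y; rewrite inner_conj -adjointP // -inner_conj. Qed.

Lemma nrm_adjointK A x : bounded_operator A ->
  nrm (adjoint (adjoint A) x) = nrm (A x).
Proof.
move=> hA; congr nrm; apply: inner_ext => z.
by rewrite -adjointP ?adjointPr //; exact: adjoint_bounded.
Qed.

End BoundedOperators.

(** * Polynomial approximation on an interval *)

Section Bernstein.
Variable R : realType.
Implicit Types (f : R -> R) (g h : nat -> R) (s e M : R) (p q : {poly R}).

(** [bernstein n g] is the usual sum of [g k * 'C(n, k) * 'X^k * (1 - 'X)^(n - k)]
    over [k], that is the expectation of [g] under the binomial law. Conditioning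
    on the first trial gives this recursion, by which the properties below are
    proved without binomial coefficients. *)
Fixpoint bernstein (n : nat) (g : nat -> R) : {poly R} :=
  if n is n'.+1 then 'X * bernstein n' (g \o succn) + (1 - 'X) * bernstein n' g
  else (g 0%N)%:P.

Lemma bernsteinS n g s : (bernstein n.+1 g).[s] =
  s * (bernstein n (g \o succn)).[s] + (1 - s) * (bernstein n g).[s].
Proof. by rewrite /= !hornerE. Qed.

Lemma ler_bernstein n g h s : 0 <= s <= 1 ->
  (forall k, (k <= n)%N -> g k <= h k) ->
  (bernstein n g).[s] <= (bernstein n h).[s].
Proof.
move=> /andP[s0 s1]; elim: n g h => [|n IH] g h gh; first by rewrite !hornerE gh.
rewrite !bernsteinS lerD // ler_wpM2l // ?subr_ge0 //.
  by apply: IH => k kn; exact: gh.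
by apply: IH => k kn; apply: gh; exact: leqW.
Qed.

(** Mean and variance of the binomial law, in the only combination needed. *)
Lemma bernstein_quadratic n a c b s :
  (bernstein n (fun k => a + c * (k%:R - b) ^+ 2)).[s] =
  a + c * ((n%:R * s - b) ^+ 2 + n%:R * (s * (1 - s))).
Proof.
elim: n b => [|n IH] b; first by rewrite /= !hornerE; ring.
rewrite bernsteinS IH.
rewrite (_ : _ \o succn = fun k => a + c * (k%:R - (b - 1)) ^+ 2); last first.
  by apply/funext => k /=; rewrite -natr1; ring.
by rewrite IH -natr1; ring.
Qed.

(** Equivalent to uniform continuity on each [[0, M]]; Bernstein's proof uses
    continuity in this form, since a quadratic error averages to a variance. *)
Definition quadratic_modulus f := forall M e, 0 < e ->
  exists C, forall x y, 0 <= x <= M -> 0 <= y <= M ->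
    f x - f y <= e + C * (x - y) ^+ 2.

(** The Bernstein polynomial of [f] at [u] averages the values [f (x i)] over
    points [x i] whose mean is [s] and whose variance is [O(1/n)], so it differs
    from [f s] by at most [e / 2 + C * variance]. The interval is enlarged to
    [[0, L]] with [L = M + 1] so that one may divide by its length. *)
Lemma weierstrass f M e : quadratic_modulus f -> 0 < e ->
  exists q, forall s, 0 <= s <= M -> `|q.[s] - f s| <= e.
Proof.
move=> hf e0; have [M0|M0] := ltP M 0.
  by exists 0 => s /andP[s0 sM]; move: (le_trans s0 sM); rewrite leNgt M0.
pose L := M + 1; have L0 : 0 < L by rewrite /L; lra.
have e20 : 0 < e / 2 by rewrite divr_gt0.
have [C hC] := hf L _ e20.
have D0 : 0 < `|C| * L ^+ 2 + 1.
  by rewrite ltr_pwDr // mulr_ge0 // sqr_ge0.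
have [n n0 hn] : exists2 n, 0 < n%:R :> R &
    n%:R^-1 * (`|C| * L ^+ 2 + 1) < e / 2.
  have [k] := ltr_add_invr (divr_gt0 e20 D0).
  by rewrite add0r ltr_pdivlMr // => hk; exists k.+1.
pose x (i : nat) := L * (i%:R / n%:R).
exists (bernstein n (f \o x) \Po (L^-1 *: 'X)) => s /andP[s0 sM].
rewrite horner_comp hornerZ hornerX; set u := L^-1 * s.
have sE : s = L * u by rewrite /u mulVKf // gt_eqF.
have u0 : 0 <= u by rewrite /u mulr_ge0 // invr_ge0 ltW.
have u1 : u <= 1 by rewrite /u ler_pdivrMl // /L; lra.
have sL : 0 <= s <= L by rewrite s0 /= /L; lra.
have xL i : (i <= n)%N -> 0 <= x i <= L.
  move=> iN; have h0 : 0 <= i%:R / n%:R :> R by rewrite divr_ge0.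
  have h1 : i%:R / n%:R <= 1 :> R by rewrite ler_pdivrMr // mul1r ler_nat.
  by rewrite /x mulr_ge0 ?(ltW L0) //= ler_piMr // ltW.
pose c := `|C| * (L / n%:R) ^+ 2.
have hx i : C * (x i - s) ^+ 2 <= c * (i%:R - n%:R * u) ^+ 2.
  have -> : x i - s = L / n%:R * (i%:R - n%:R * u).
    by rewrite sE /x; field; rewrite gt_eqF.
  by rewrite exprMn mulrA ler_wpM2r ?sqr_ge0 // ler_wpM2r ?sqr_ge0 // ler_norm.
have hc : c * (n%:R * (u * (1 - u))) <= e / 2.
  have -> : c * (n%:R * (u * (1 - u))) = n%:R^-1 * (`|C| * L ^+ 2) * (u * (1 - u)).
    by rewrite /c; field; rewrite gt_eqF.
  have i0 : 0 < n%:R^-1 :> R by rewrite invr_gt0.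
  have C0 : 0 <= `|C| * L ^+ 2 by rewrite mulr_ge0 // sqr_ge0.
  have P0 : 0 <= n%:R^-1 * (`|C| * L ^+ 2) by rewrite mulr_ge0 // ltW.
  have : u * (1 - u) <= 1 by nra.
  move=> /(ler_wpM2l P0); move: hn.
  by move: (n%:R^-1) i0 => i i0; lra.
rewrite ler_distl; apply/andP; split.
  apply: (@le_trans _ _ (bernstein n (fun i => (f s - e / 2)
      + - c * (i%:R - n%:R * u) ^+ 2)).[u]).
    by rewrite bernstein_quadratic subrr expr0n /= add0r mulNr; lra.
  apply: ler_bernstein => [|i iN /=]; first by rewrite u0.
  have := hC _ _ sL (xL i iN); have := hx i; rewrite -[s - x i]opprB sqrrN; lra.
apply: (@le_trans _ _ (bernstein n (fun i => (f s + e / 2)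
      + c * (i%:R - n%:R * u) ^+ 2)).[u]); last first.
  by rewrite bernstein_quadratic subrr expr0n /= add0r; lra.
apply: ler_bernstein => [|i iN /=]; first by rewrite u0.
have := hC _ _ (xL i iN) sL; have := hx i; lra.
Qed.

End Bernstein.

Section PowerFunction.
Variable R : realType.
Implicit Types (s c r u : R).

(** Young's inequality for [u * 1] with exponents [r] and [r / (r - 1)]. *)
Lemma bernoulli_powR u r : 0 <= u -> 1 <= r -> 1 + r * (u - 1) <= u `^ r.
Proof.
move=> u0; rewrite le_eqVlt => /predU1P[<-|r1]; first by rewrite powRr1 //; lra.
have r0 : 0 < r by lra.
have q0 : 0 < r / (r - 1) by rewrite divr_gt0 //; lra.
have := conjugate_powR u0 ler01 r0 q0; rewrite mulr1 powR1 mul1r invf_div.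
have -> : r^-1 + (r - 1) / r = 1 by field; lra.
move=> /(_ erefl); rewrite -mulrDl ler_pdivlMr //; lra.
Qed.

Lemma powR_tangent s c r : 0 <= s -> 0 < c -> 1 <= r ->
  c `^ r + r * c `^ (r - 1) * (s - c) <= s `^ r.
Proof.
move=> s0 c0 r1; have u0 : 0 <= s / c by rewrite divr_ge0 // ltW.
have cr : 0 < c `^ r by rewrite powR_gt0.
have -> : s `^ r = c `^ r * (s / c) `^ r.
  by rewrite -powRM ?(ltW c0) // mulrCA divff ?mulr1 // gt_eqF.
have -> : c `^ (r - 1) = c `^ r / c 
  by rewrite powRB ?(gt_eqF c0) ?implybT // powRr1 // ltW.
have := ler_wpM2l (ltW cr) (bernoulli_powR u0 r1).
suff -> : c `^ r * (1 + r * (s / c - 1)) = c `^ r + r * (c `^ r / c) * (s - c) by [].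
by field; rewrite gt_eqF.
Qed.

(** The tangent at the larger point shows that [s^r] is [L]-Lipschitz on
    [[0, M]], and [L h <= e + (L h)^2 / (4 e)]. *)
Lemma quadratic_modulus_powR r : 1 <= r -> quadratic_modulus (fun s => s `^ r).
Proof.
move=> r1 M e e0; pose L := r * M `^ (r - 1); exists (L ^+ 2 / (4 * e)).
move=> x y /andP[x0 xM] /andP[y0 yM].
have C0 : 0 <= L ^+ 2 / (4 * e) by rewrite divr_ge0 ?sqr_ge0 //; lra.
have [xy|yx] := leP x y.
  have : x `^ r <= y `^ r by apply: ge0_ler_powR; rewrite ?nnegrE //; lra.
  have := mulr_ge0 C0 (sqr_ge0 (x - y)); lra.
have xp : 0 < x by lra.
have h1 := powR_tangent y0 xp r1.
have h2 : x `^ (r - 1) <= M `^ (r - 1) by apply: ge0_ler_powR; rewrite ?nnegrE //; lra.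
have h3 : x `^ r - y `^ r <= L * (x - y).
  have := ler_wpM2r (_ : 0 <= r * (x - y)) h2; rewrite /L.
  have : 0 <= r * (x - y) by nra.
  move=> h0 /(_ h0); lra.
apply: le_trans h3 _; rewrite -lerBlDl.
have -> : L ^+ 2 / (4 * e) * (x - y) ^+ 2 = (L * (x - y)) ^+ 2 / (4 * e).
  by field; rewrite gt_eqF.
rewrite ler_pdivlMr; last by lra.
have := sqr_ge0 (2 * e - L * (x - y)); lra.
Qed.

(** With [w = |sqrt x - sqrt y|], one has [w^2 <= |x - y|], and
    [w <= w^4 / e^3] as soon as [w > e]. *)
Lemma quadratic_modulus_sqrt : quadratic_modulus (@Num.sqrt R).
Proof.
move=> M e e0; exists (e ^- 3) => x y /andP[x0 _] /andP[y0 _].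
have C0 : 0 < e ^- 3 by rewrite invr_gt0 exprn_gt0.
set a := Num.sqrt x; set b := Num.sqrt y.
have a0 : 0 <= a := sqrtr_ge0 x. have b0 : 0 <= b := sqrtr_ge0 y.
have -> : x = a ^+ 2 by rewrite sqr_sqrtr.
have -> : y = b ^+ 2 by rewrite sqr_sqrtr.
have [h|h] := leP (a - b) e.
  by rewrite -[leLHS]addr0 lerD // mulr_ge0 ?sqr_ge0 // ltW.
apply: (@le_trans _ _ (e ^- 3 * (a ^+ 2 - b ^+ 2) ^+ 2)); last by rewrite lerDr ltW.
rewrite ler_pdivlMl ?exprn_gt0 //; set w := a - b.
have w0 : 0 < w by rewrite /w; lra.
have h3 : e ^+ 3 <= w ^+ 3 by rewrite lerXn2r ?nnegrE ?ltW.
apply: (@le_trans _ _ (w ^+ 3 * w)); first by rewrite ler_wpM2r // ltW.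
have -> : w ^+ 3 * w = (w ^+ 2) ^+ 2 by ring.
rewrite lerXn2r ?nnegrE ?sqr_ge0 // /w; nra.
Qed.

End PowerFunction.

(** * Polynomials that are nonnegative on an interval *)

Section IntervalCone.
Variable R : realType.
Implicit Types (s c M a b : R) (p q : {poly R}).

(** The polynomials that are visibly nonnegative on [[0, M]]. *)
Inductive interval_cone M : {poly R} -> Prop :=
| cone_const c : 0 <= c -> interval_cone M c%:P
| cone_add p q : interval_cone M p -> interval_cone M q -> interval_cone M (p + q)
| cone_mulX p : interval_cone M p -> interval_cone M (p * 'X)
| cone_mulBX p : interval_cone M p -> interval_cone M (p * (M%:P - 'X))
| cone_mulsq a p : interval_cone M p -> interval_cone M (p * ('X - a%:P) ^+ 2).

(** By continuity; this is what allows a division by ['X - c]. *)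
Lemma poly_ge0_closure q a b c : a < b -> a <= c <= b ->
  (forall s, a <= s <= b -> s != c -> 0 <= q.[s]) -> 0 <= q.[c].
Proof.
move=> ab /andP[ac cb] hq; rewrite leNgt; apply/negP => qc.
have : \forall s \near c, q.[s] < 0.
  exact: (cvgr_lt q.[c] (@continuous_horner R q c) 0 qc).
move=> /nbhs_ballP[d /= d0 hd].
have near0 s : a <= s <= b -> s != c -> `|c - s| < d -> False.
  by move=> sab sc /hd /=; rewrite ltNge hq.
have [cb'|bc] := ltP c b.
  pose m := Num.min (d / 2) (b - c).
  have m0 : 0 < m by rewrite /m lt_min divr_gt0 //= subr_gt0.
  have md : m <= d / 2 by rewrite /m ge_min lexx.
  have mb : m <= b - c by rewrite /m ge_min lexx orbT.
  apply: (near0 (c + m)); [lra|lra|].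
  by rewrite opprD addNKr normrN gtr0_norm //; lra.
pose m := Num.min (d / 2) (c - a).
have m0 : 0 < m by rewrite /m lt_min divr_gt0 //=; lra.
have md : m <= d / 2 by rewrite /m ge_min lexx.
have mb : m <= c - a by rewrite /m ge_min lexx orbT.
apply: (near0 (c - m)); [lra|lra|].
by rewrite opprB addrC subrK gtr0_norm //; lra.
Qed.

(** On the degenerate interval the cone contains both ['X] and [- 'X], hence all
    multiples of ['X]. *)
Lemma interval_cone0 p : 0 <= p.[0] -> interval_cone 0 p.
Proof.
have mulX q : interval_cone 0 (q * 'X).
  elim/poly_ind: q => [|q c IH]; first by rewrite mul0r -polyC0; exact: cone_const.
  rewrite mulrDl; apply: cone_add; first exact: cone_mulX.
  have [c0|c0] := leP 0 c; first by apply: cone_mulX; exact: cone_const.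
  have -> : c%:P * 'X = (- c)%:P * (0%:P - 'X) by rewrite polyCN sub0r mulrNN.
  by apply: cone_mulBX; apply: cone_const; rewrite oppr_ge0 ltW.
elim/poly_ind: p => [|p c _]; first by move=> _; rewrite -polyC0; exact: cone_const.
rewrite !hornerE => c0; apply: cone_add; [exact: mulX|exact: cone_const].
Qed.

(** Induction on the degree. Subtract from [p] its minimum, attained at [c], and
    divide by ['X - c]. At an end of the interval the quotient has a constant
    sign; at an interior point [c] is a double root, and [p] is divided by the
    square of ['X - c]. *)
Lemma interval_coneP M p : 0 <= M ->
  (forall s, 0 <= s <= M -> 0 <= p.[s]) -> interval_cone M p.
Proof.
rewrite le_eqVlt => /predU1P[<- h|M0].
  by apply: interval_cone0; apply: h; rewrite lexx.
have [n] := ubnP (size p); elim: n p => // n IH p szp p0.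
have [c] := EVT_min (ltW M0) (@continuous_subspaceT _ _ _ _ (@continuous_horner R p)).
rewrite in_itv /= => /andP[c0 cM] cmin.
have pmin s : 0 <= s <= M -> 0 <= p.[s] - p.[c].
  by move=> hs; rewrite subr_ge0 cmin // in_itv.
have pc0 : 0 <= p.[c] by apply: p0; rewrite c0.
have [szp1|szp1] := leqP (size p) 1.
  have pC := size1_polyC szp1; rewrite pC; apply: cone_const.
  by have := p0 0; rewrite lexx (ltW M0) => /(_ isT); rewrite {1}pC hornerC.
have /factor_theorem[q hq] : root (p - p.[c]%:P) c by rewrite /root !hornerE subrr.
have sz_q r : p - p.[c]%:P = r * ('X - c%:P) -> (size r < n)%N.
  move=> hr; have : size (p - p.[c]%:P) = size p.
    by rewrite size_polyDl // size_polyN (leq_ltn_trans (size_polyC_leq1 _)).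
  rewrite hr; have [->|r0] := eqVneq r 0.
    by rewrite mul0r size_poly0 => h; rewrite -h in szp1.
  by rewrite size_Mmonic ?monicXsubC // size_XsubC addn2 /= => h; rewrite -h in szp.
have pE : p = p.[c]%:P + q * ('X - c%:P) by rewrite -hq addrC subrK.
have qE s : q.[s] * (s - c) = p.[s] - p.[c].
  by have := congr1 (horner^~ s) hq; rewrite !hornerE => ->.
rewrite pE; apply: cone_add; first exact: cone_const.
have [cz|cn0] := eqVneq c 0.
  rewrite cz subr0; apply: cone_mulX; apply: IH => [|s hs]; first exact: sz_q.
  have hpos t : 0 <= t <= M -> t != 0 -> 0 <= q.[t].
    move=> ht tn0; have := pmin t ht; rewrite -qE cz subr0 pmulr_lge0 //.
    by rewrite lt_neqAle eq_sym tn0; case/andP: ht.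
  have [->|] := eqVneq s 0; last exact: hpos.
  by apply: (@poly_ge0_closure _ 0 M) => //; rewrite lexx ltW.
have [czM|cnM] := eqVneq c M.
  have -> : q * ('X - c%:P) = (- q) * (M%:P - 'X) by rewrite czM mulNr -mulrN opprB.
  apply: cone_mulBX; apply: IH => [|s hs]; first by rewrite size_polyN; exact: sz_q.
  have hpos t : 0 <= t <= M -> t != M -> 0 <= (- q).[t].
    move=> ht tnM; have := pmin t ht; rewrite -qE czM hornerN -mulrNN opprB.
    rewrite pmulr_lge0 // subr_gt0 lt_neqAle tnM; by case/andP: ht.
  have [->|] := eqVneq s M; last exact: hpos.
  by apply: (@poly_ge0_closure _ 0 M) => //; rewrite lexx ltW.
have c0' : 0 < c by rewrite lt_neqAle eq_sym cn0.
have cM' : c < M by rewrite lt_neqAle cnM.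
have qc0 : q.[c] = 0.
  apply/eqP; rewrite eq_le; apply/andP; split.
    rewrite -oppr_ge0 -hornerN; apply: (@poly_ge0_closure _ 0 c) => //; first lra.
    move=> s hs sc; have := pmin s; rewrite -qE hornerN -mulrNN.
    rewrite pmulr_lge0; last by rewrite oppr_gt0 subr_lt0 lt_neqAle sc; lra.
    by apply; lra.
  apply: (@poly_ge0_closure _ c M) => //; first lra.
  move=> s hs sc; have := pmin s; rewrite -qE.
  rewrite pmulr_lge0; last by rewrite subr_gt0 lt_neqAle eq_sym sc; lra.
  by apply; lra.
have /factor_theorem[r hr] : root q c by rewrite /root qc0.
have -> : q * ('X - c%:P) = r * ('X - c%:P) ^+ 2 by rewrite hr expr2 mulrA.
apply: cone_mulsq; apply: IH => [|s hs].
  have := sz_q q hq; rewrite hr; have [->|r0] := eqVneq r 0.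
    by rewrite mul0r.
  by rewrite size_Mmonic ?monicXsubC // size_XsubC addn2 /=; exact: ltn_trans.
have hpos t : 0 <= t <= M -> t != c -> 0 <= r.[t].
  move=> ht tc; have := pmin t ht; rewrite -qE hr !hornerE -mulrA -expr2.
  by rewrite pmulr_lge0 // exprn_even_gt0 //= subr_eq0.
have [->|] := eqVneq s c; last exact: hpos.
by apply: (@poly_ge0_closure _ 0 M) => //; rewrite c0.
Qed.

End IntervalCone.

(** * Polynomials of a positive operator *)

Section OperatorPolynomials.
Variables (R : realType) (H : hilbertType R).
Implicit Types (x y z : H) (S T : H -> H) (p q : {poly R}) (M e : R).

Lemma real_complexD (a b : R) : (a + b)%:C = a%:C + b%:C :> R[i].
Proof. exact: rmorphD. Qed.
Lemma real_complexM (a b : R) : (a * b)%:C = a%:C * b%:C :> R[i].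
Proof. exact: rmorphM. Qed.

Lemma innerZr_real (r : R) x y : inner x (r%:C *: y) = r%:C * inner x y.
Proof. by rewrite innerZr; congr (_ * _); apply/eqP; rewrite eq_complex /= oppr0 !eqxx. Qed.

Lemma op_poly_widen n q T x : (size q <= n)%N ->
  op_poly q T x = \sum_(i < n) (q`_i)%:C *: iter i T x.
Proof.
move=> qn; rewrite /op_poly (big_ord_widen _ (fun i => (q`_i)%:C *: iter i T x) qn).
rewrite big_mkcond /=; apply: eq_bigr => i _; case: ltnP => // h.
by rewrite nth_default // scale0r.
Qed.

Lemma op_polyD p q T x : op_poly (p + q) T x = op_poly p T x + op_poly q T x.
Proof.
pose n := maxn (size p) (size q).
rewrite !(@op_poly_widen n) ?leq_maxl ?leq_maxr ?size_polyD // -big_split /=.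
by apply: eq_bigr => i _; rewrite coefD real_complexD scalerDl.
Qed.

Lemma op_polyC (c : R) T x : op_poly c%:P T x = c%:C *: x.
Proof. by rewrite (op_poly_widen _ _ (size_polyC_leq1 c)) big_ord1 coefC. Qed.

Lemma op_polyMX q T x : op_poly (q * 'X) T x = op_poly q T (T x).
Proof.
rewrite (@op_poly_widen (size q).+1); last first.
  by apply: leq_trans (size_polyMleq _ _) _; rewrite size_polyX addn2.
rewrite big_ord_recl coefMX /= scale0r add0r; apply: eq_bigr => i _.
by rewrite coefMX /= add0n -iterS iterSr.
Qed.


Lemma nrm_bounded x y e : (`|y| <= e%:C * `|x|) = (nrm y <= e * nrm x).
Proof. by rewrite !nrmE -real_complexM lecR. Qed.

Variable T : H -> H.
Hypothesis linT : linear T.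

Lemma op_polyZ (c : R) q x : op_poly (c *: q) T x = c%:C *: op_poly q T x.
Proof.
elim/poly_ind: q x => [|q d IH] x.
  by rewrite scaler0 -polyC0 op_polyC !scale0r scaler0.
rewrite scalerDr scalerAl !op_polyD !op_polyMX IH scale_polyC !op_polyC scalerDr.
by rewrite scalerA real_complexM.
Qed.

Lemma op_polyN q x : op_poly (- q) T x = - op_poly q T x.
Proof. by rewrite -scaleN1r op_polyZ rmorphN scaleN1r. Qed.

Lemma op_poly_linear q : linear (op_poly q T).
Proof.
elim/poly_ind: q => [|q d IH] a x y; first by rewrite -polyC0 !op_polyC !scale0r scaler0 addr0.
rewrite !op_polyD !op_polyMX linT IH !op_polyC !scalerDr !scalerA mulrC.
by rewrite addrACA.
Qed.

Lemma op_polyM p q x : op_poly (p * q) T x = op_poly p T (op_poly q T x).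
Proof.
elim/poly_ind: q x => [|q d IH] x.
  by rewrite mulr0 -polyC0 !op_polyC !scale0r (lin0 (op_poly_linear p)).
rewrite mulrDr mulrA !op_polyD !op_polyMX IH (linD _ _ (op_poly_linear p)).
by rewrite mulrC mul_polyC op_polyZ op_polyC (linZ _ _ (op_poly_linear p)).
Qed.

Lemma op_polyX x : op_poly 'X T x = T x.
Proof. by rewrite -[X in op_poly X]mul1r op_polyMX op_polyC scale1r. Qed.

Lemma op_poly_bounded q (K : R) : (forall x, nrm (T x) <= K * nrm x) ->
  exists2 L : R, 0 <= L & forall x, nrm (op_poly q T x) <= L * nrm x.
Proof.
move=> hK; elim/poly_ind: q => [|q d [L L0 IH]].
  by exists 0 => // x; rewrite -polyC0 op_polyC scale0r nrm0 mul0r.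
exists (L * `|K| + `|d|) => [|x]; first by rewrite addr_ge0 // mulr_ge0.
rewrite op_polyD op_polyMX op_polyC mulrDl; apply: le_trans (ler_nrmD _ _) _.
rewrite nrmZr lerD2r -mulrA; apply: le_trans (IH _) _; apply: ler_wpM2l => //.
by apply: le_trans (hK x) _; rewrite ler_wpM2r ?nrm_ge0 // ler_norm.
Qed.

Lemma positive_rinner_ge0 : positive_operator T -> forall x, 0 <= rinner (T x) x.
Proof. by move=> posT x; have := posT x; rewrite lecE => /andP[]. Qed.

(** The quadratic form of a positive operator is real, so by polarization the
    operator is symmetric. *)
Lemma positive_symmetric : positive_operator T ->
  forall x y, inner (T x) y = inner x (T y).
Proof.
move=> posT x y.
have im z : complex.Im (inner (T z) z) = 0 by apply: ger0_Im; exact: posT.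
rewrite [RHS]inner_conj.
have := im (x + y); have := im (x + 'i *: y); have := im x; have := im y.
rewrite !(linD _ _ linT) (linZ _ _ linT) !innerDl !innerDr !innerZl !innerZr.
case: (inner (T x) x) => a1 b1; case: (inner (T y) y) => a2 b2.
case: (inner (T x) y) => a b; case: (inner (T y) x) => c d /= -> -> h1 h2.
by apply/eqP; rewrite eq_complex /=; apply/andP; split; apply/eqP; lra.
Qed.

Hypothesis symT : forall x y, inner (T x) y = inner x (T y).

Lemma op_poly_symmetric q x y : inner (op_poly q T x) y = inner x (op_poly q T y).
Proof.
elim/poly_ind: q x y => [|q d IH] x y.
  by rewrite -polyC0 !op_polyC innerZl innerZr_real !mul0r.
have qT : op_poly q T (T y) = T (op_poly q T y).
  by rewrite -op_polyMX mulrC op_polyM op_polyX.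
rewrite !op_polyD !op_polyMX !op_polyC qT.
by rewrite innerDl innerDr IH symT innerZl innerZr_real.
Qed.

Definition poly_positive p := forall x, 0 <= rinner (op_poly p T x) x.

Lemma poly_positiveD p q : poly_positive p -> poly_positive q -> poly_positive (p + q).
Proof. by move=> hp hq x; rewrite op_polyD rinnerDl addr_ge0. Qed.

(** [< q(T) p(T) q(T) x, x> = < p(T) y, y>] with [y = q(T) x]. *)
Lemma poly_positiveMsq p q : poly_positive p -> poly_positive (p * q ^+ 2).
Proof.
move=> hp x; have -> : p * q ^+ 2 = q * (p * q) by ring.
by rewrite 2!op_polyM /rinner op_poly_symmetric; exact: hp.
Qed.

Variable M : R.
Hypothesis T_ge0 : forall x, 0 <= rinner (T x) x.
Hypothesis T_le : forall x, nrm (T x) <= M * nrm x.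

(** The values of the products of the two generators ['X] and [M - 'X] of the
    cone are positive. For [T (M - T)] this is [|T x|^2 <= M <T x, x>], which
    comes from positivity of the form [<T ., .>] at [M x - T x]. *)
Lemma poly_positive_gen : 0 <= M ->
  [/\ poly_positive 'X, poly_positive (M%:P - 'X) & poly_positive ('X * (M%:P - 'X))].
Proof.
move=> M0; split=> x.
- by rewrite op_polyX.
- rewrite op_polyD op_polyN op_polyC op_polyX rinnerBl rinnerZl rinner_nrm subr_ge0.
  apply: le_trans (rinner_le _ _) _.
  by rewrite expr2 mulrA ler_wpM2r ?nrm_ge0.
rewrite op_polyM op_polyX op_polyD op_polyN op_polyC op_polyX.
rewrite (linB _ _ linT) (linZ _ _ linT) rinnerBl rinnerZl.
have sqT : rinner (T (T x)) x = nrm (T x) ^+ 2.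
  by rewrite /rinner symT -/(rinner _ _) rinner_nrm.
rewrite sqT.
have [M0'|Mp] := leP M 0.
  have : nrm (T x) <= 0.
    by apply: le_trans (T_le x) _; rewrite mulr_le0_ge0 ?nrm_ge0.
  by have := nrm_ge0 (T x); have := T_ge0 x; nra.
have := T_ge0 (M%:C *: x - T x).
rewrite (linB _ _ linT) (linZ _ _ linT) !rinnerBl !rinnerBr !rinnerZl !rinnerZr.
rewrite rinner_nrm sqT.
have : rinner (T (T x)) (T x) <= M * nrm (T x) ^+ 2.
  apply: le_trans (rinner_le _ _) _.
  by rewrite expr2 mulrA ler_wpM2r ?nrm_ge0.
move=> h1 h2.
by rewrite -(pmulr_rge0 _ Mp); lra.
Qed.

Lemma interval_cone_positive p : 0 <= M -> interval_cone M p -> poly_positive p.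
Proof.
move=> M0 hp; have [hX hB hXB] := poly_positive_gen M0.
(* Positivity of [p] alone is not inductive: it must be carried along with the
   products of [p] and the generators. *)
suff [] : [/\ poly_positive p, poly_positive (p * 'X),
    poly_positive (p * (M%:P - 'X)) & poly_positive (p * ('X * (M%:P - 'X)))] by [].
elim: hp => {p} [c c0|p q _ [p1 p2 p3 p4] _ [q1 q2 q3 q4]|p _ [p1 p2 p3 p4]
    |p _ [p1 p2 p3 p4]|a p _ [p1 p2 p3 p4]].
- have cM r : poly_positive r -> poly_positive (c%:P * r).
    by move=> hr x; rewrite mul_polyC op_polyZ rinnerZl mulr_ge0.
  split; [|exact: cM..].
  by move=> x; rewrite op_polyC rinnerZl mulr_ge0 // rinner_nrm sqr_ge0.
- by rewrite !mulrDl; split; exact: poly_positiveD.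
- split=> //.
  + by rewrite -mulrA -expr2; exact: poly_positiveMsq.
  + by rewrite -mulrA.
  + have -> : p * 'X * ('X * (M%:P - 'X)) = p * (M%:P - 'X) * 'X ^+ 2 by ring.
    exact: poly_positiveMsq.
- split=> //.
  + by rewrite -mulrA [_ * 'X]mulrC.
  + by rewrite -mulrA -expr2; exact: poly_positiveMsq.
  + have -> : p * (M%:P - 'X) * ('X * (M%:P - 'X)) = p * 'X * (M%:P - 'X) ^+ 2 by ring.
    exact: poly_positiveMsq.
- by rewrite ![p * _ ^+ 2 * _]mulrAC; split; exact: poly_positiveMsq.
Qed.

Lemma poly_positiveP p : 0 <= M -> (forall s, 0 <= s <= M -> 0 <= p.[s]) ->
  poly_positive p.
Proof. by move=> M0 hp; apply: interval_cone_positive => //; exact: interval_coneP. Qed.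

(** If [|q| <= e] on [[0, M]], then [e^2 - q^2] is nonnegative there. *)
Lemma nrm_op_poly_le q e x : (forall s, 0 <= s <= M -> `|q.[s]| <= e) ->
  nrm (op_poly q T x) <= e * nrm x.
Proof.
move=> hq; have [M0|M0] := ltP M 0.
  have : nrm x == 0.
    have := le_trans (nrm_ge0 _) (T_le x).
    by rewrite nmulr_rge0 // eq_le nrm_ge0 andbT.
  by rewrite nrm_eq0 => /eqP ->; rewrite (lin0 (op_poly_linear q)) nrm0 mulr0.
have e0 : 0 <= e by apply: le_trans (normr_ge0 _) (hq 0 _); rewrite lexx.
have /(_ x) : poly_positive ((e ^+ 2)%:P - q ^+ 2).
  apply: poly_positiveP => // s /hq; rewrite !hornerE ler_norml => /andP[h1 h2]; nra.
rewrite op_polyD op_polyN op_polyC rinnerBl rinnerZl rinner_nrm op_polyM.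
rewrite [rinner (op_poly _ _ (op_poly _ _ _)) _]/rinner op_poly_symmetric.
rewrite -/(rinner _ _) rinner_nrm subr_ge0 -exprMn => h.
by rewrite -ler_sqr ?nnegrE ?mulr_ge0 ?nrm_ge0.
Qed.

End OperatorPolynomials.

(** * Continuous functional calculus, square roots and absolute values *)

Section FunctionalCalculus.
Variables (R : realType) (H : hilbertType R).
Implicit Types (x y z : H) (S T : H -> H) (q : {poly R}) (M e : R).

Lemma normr_Im_le_normc (a : R[i]) : `|complex.Im a| <= ComplexField.Normc.normc a.
Proof. by case: a => a b /=; rewrite -sqrtr_sqr ler_wsqrtr // lerDr sqr_ge0. Qed.

(** Polynomials close to [f] on [[0, M]] are close to each other there, so their
    values at [T] form a Cauchy sequence. *)
Lemma op_funP (f : R -> R) T : quadratic_modulus f ->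
  bounded_operator T -> positive_operator T ->
  bounded_operator (op_fun f T) /\
  forall M q e, (forall x, nrm (T x) <= M * nrm x) ->
    (forall s, 0 <= s <= M -> `|q.[s] - f s| <= e) ->
    forall x, nrm (op_poly q T x - op_fun f T x) <= e * nrm x.
Proof.
move=> hf bT posT.
have [linT [K K0 hK]] := (bounded_operatorP _).1 bT.
have symT := positive_symmetric linT posT.
have T_ge0 := positive_rinner_ge0 posT.
suff : exists S, bounded_operator S /\
    forall M q e, (forall x, nrm (T x) <= M * nrm x) ->
    (forall s, 0 <= s <= M -> `|q.[s] - f s| <= e) ->
    forall x, nrm (op_poly q T x - S x) <= e * nrm x.
  move=> [S [bS hS]]; rewrite /op_fun; set E := (X in get X).
  have : E (get E).
    apply: (@getPex _ E); exists S; split=> // M q e hM hq x.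
    by rewrite nrm_bounded; apply: hS hq _ => y; rewrite -nrm_bounded; exact: hM.
  move=> [bE hE]; split=> // M q e hM hq x.
  by rewrite -nrm_bounded; apply: hE hq _ => y; rewrite nrm_bounded; exact: hM.
have /choice[q hq] n : exists q, forall s, 0 <= s <= K -> `|q.[s] - f s| <= n.+1%:R^-1.
  by apply: weierstrass => //; rewrite invr_gt0.
have approx M p e n x : (forall x, nrm (T x) <= M * nrm x) ->
    (forall s, 0 <= s <= M -> `|p.[s] - f s| <= e) ->
    nrm (op_poly p T x - op_poly (q n) T x) <= (e + n.+1%:R^-1) * nrm x.
  move=> hM hp; rewrite -op_polyN // -op_polyD.
  (* The two polynomials approximate [f] on different intervals; both do so on
     the shorter one, whose length still bounds the norm of [T]. *)
  apply: (@nrm_op_poly_le _ _ _ linT symT (Num.min M K)) => //.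
    by move=> y; rewrite /Num.min; case: ifP.
  move=> s; rewrite le_min => /and3P[s0 sM sK].
  have := hp s; have := hq n s; rewrite s0 sM sK => /(_ isT) h1 /(_ isT) h2.
  rewrite !hornerE; have -> : p.[s] - (q n).[s] = (p.[s] - f s) - ((q n).[s] - f s) by ring.
  by apply: le_trans (ler_normB _ _) _; exact: lerD.
have /choice[S hS] x : exists z, forall n, nrm (op_poly (q n) T x - z) <= nrm x * n.+1%:R^-1.
  apply: nrm_complete => m n; rewrite mulrC.
  exact: (approx K) (hq m).
exists S; split.
  apply/bounded_operatorP; split.
    move=> a x y; apply/eqP; rewrite -subr_eq0 -nrm_eq0 eq_le nrm_ge0 andbT.
    apply: (@le0_natSinv _ _ (nrm (a *: x + y) +
      (ComplexField.Normc.normc a * nrm x + nrm y))) => n.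
    have -> : S (a *: x + y) - (a *: S x + S y) =
        (S (a *: x + y) - op_poly (q n) T (a *: x + y)) +
        (a *: (op_poly (q n) T x - S x) + (op_poly (q n) T y - S y)).
      by rewrite op_poly_linear // scalerBr [X in _ = _ + X]addrACA -opprD addrA subrK.
    rewrite mulrDl; apply: le_trans (ler_nrmD _ _) _; apply: lerD.
      by rewrite nrmB.
    rewrite mulrDl; apply: le_trans (ler_nrmD _ _) _; apply: lerD; last exact: hS.
    by rewrite nrmZ -mulrA ler_wpM2l ?normc_ge0.
  have [L L0 hL] := op_poly_bounded (q 0%N) hK.
  exists (L + 1) => [|x]; first by rewrite addr_ge0.
  have := hS x 0%N; have := hL x; have := ler_nrmD (op_poly (q 0%N) T x) (S x - op_poly (q 0%N) T x).
  by rewrite subrKC nrmB invr1; lra.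
move=> M p e hM hp x; rewrite -subr_le0; apply: (@le0_natSinv _ _ (nrm x + nrm x)) => n.
have := approx M p e n x hM hp; have := hS x n.
have := ler_nrmB (op_poly (q n) T x) (op_poly p T x) (S x); move: (n.+1%:R^-1). move=> i; lra.
Qed.

(** If [q_n] tends to the square root on [[0, K]], then [q_n^2 - 'X] tends to
    zero there, so [q_n(T)^2] tends both to [S^2] and to [T]. *)
Lemma positive_sqrt T : bounded_operator T -> positive_operator T ->
  exists S, [/\ bounded_operator S, positive_operator S & S \o S = T].
Proof.
move=> bT posT.
have [bS hS] := op_funP (@quadratic_modulus_sqrt R) bT posT.
set S := op_fun _ T in bS hS.
have [linT [K K0 hK]] := (bounded_operatorP _).1 bT.
have [linS [L L0 hL]] := (bounded_operatorP _).1 bS.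
have symT := positive_symmetric linT posT.
have T_ge0 := positive_rinner_ge0 posT.
have /choice[q hq] n : exists q, forall s, 0 <= s <= K ->
    `|q.[s] - Num.sqrt s| <= n.+1%:R^-1.
  by apply: weierstrass; [exact: quadratic_modulus_sqrt|rewrite invr_gt0].
have inv_le1 n : 0 < (n.+1%:R^-1 : R) <= 1.
  by rewrite invr_gt0 ltr0n /= invf_le1 // ler1n.
exists S; split=> //.
  move=> x; rewrite lecE; apply/andP; split; last first.
    change (0 <= rinner (S x) x).
    rewrite -oppr_le0; apply: (@le0_natSinv _ _ (2 * nrm x ^+ 2)) => n.
    have /(_ x) : poly_positive T (q n + n.+1%:R^-1%:P).
      apply: (poly_positiveP linT symT T_ge0 hK K0) => s /(hq n).
      rewrite !hornerE ler_norml => /andP[+ _]; have := sqrtr_ge0 s.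
      by move: (Num.sqrt s) (n.+1%:R^-1) => r i; lra.
    rewrite op_polyD op_polyC rinnerDl rinnerZl rinner_nrm => h1.
    have := ler_wpM2r (nrm_ge0 x) (hS _ _ _ hK (hq n) x).
    have := rinner_le (op_poly (q n) T x - S x) x.
    rewrite rinnerBl; move: h1; move: (n.+1%:R^-1) => i; lra.
  rewrite -normr_le0; apply: (@le0_natSinv _ _ (nrm x ^+ 2)) => n.
  have -> : complex.Im (inner (S x) x) = complex.Im (inner (S x - op_poly (q n) T x) x).
    have : inner (op_poly (q n) T x) x = (inner (op_poly (q n) T x) x)^*.
      by rewrite -inner_conj op_poly_symmetric.
    rewrite innerBl; case: (inner (S x) x) => a b.
    by case: (inner (op_poly (q n) T x) x) => c d /= [] ?; lra.
  apply: le_trans (normr_Im_le_normc _) (le_trans (normc_inner_le _ _) _).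
  have := ler_wpM2r (nrm_ge0 x) (hS _ _ _ hK (hq n) x).
  by rewrite (nrmB (S x)); move: (n.+1%:R^-1) => i; lra.
apply/funext => x /=; apply/eqP; rewrite -subr_eq0 -nrm_eq0 eq_le nrm_ge0 andbT.
pose rK := Num.sqrt K.
apply: (@le0_natSinv _ _ ((2 * rK + 1 + L + (L + 1)) * nrm x)) => n.
set e : R := n.+1%:R^-1; have /andP[e0 e1] : 0 < e <= 1 by exact: inv_le1.
set Q := op_poly (q n) T.
have hQS y : nrm (Q y - S y) <= e * nrm y by exact: hS (hq n) y.
have hQ : nrm (Q (Q x) - T x) <= (2 * rK + 1) * e * nrm x.
  rewrite /Q -op_polyM // -[X in _ - X]op_polyX -op_polyN // -op_polyD.
  apply: (nrm_op_poly_le linT symT T_ge0 hK) => s hs.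
  rewrite !hornerE; have /andP[s0 sK] := hs.
  have a0 := sqrtr_ge0 s; have aK : Num.sqrt s <= rK by rewrite ler_sqrt.
  have := hq n s hs; have := sqr_sqrtr s0.
  move: (Num.sqrt s) a0 aK => a a0 aK a2 h.
  have -> : (q n).[s] * (q n).[s] - s = ((q n).[s] + a) * ((q n).[s] - a) by lra.
  rewrite normrM.
  have : `|(q n).[s] + a| <= 2 * rK + 1.
    by move: h; rewrite !ler_norml -/e; lra.
  by move=> h2; apply: ler_pM.
have h1 : nrm (S (S x - Q x)) <= L * (e * nrm x).
  by apply: le_trans (hL _) _; rewrite ler_wpM2l // nrmB.
have h2 : nrm (S (Q x) - Q (Q x)) <= e * ((L + 1) * nrm x).
  rewrite nrmB; apply: le_trans (hQS _) _; apply: ler_wpM2l; first exact: ltW.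
  have := ler_nrmD (S x) (Q x - S x); rewrite subrKC => h3.
  have := hL x; have := hQS x; have := ler_wpM2r (nrm_ge0 x) e1; lra.
have := ler_nrmB (S (Q x)) (S (S x)) (T x); rewrite -linB // => h3.
have := ler_nrmB (Q (Q x)) (S (Q x)) (T x); lra.
Qed.

Lemma op_absP A : bounded_operator A ->
  [/\ bounded_operator (op_abs A), positive_operator (op_abs A) &
      forall x, nrm (op_abs A x) = nrm (A x)].
Proof.
move=> bA; have adjA := adjointPr bA.
have [linB [L L0 hL]] := (bounded_operatorP _).1 (adjoint_bounded bA).
have [linA [K K0 hK]] := (bounded_operatorP _).1 bA.
have bT : bounded_operator (adjoint A \o A).
  apply/bounded_operatorP; split; first by move=> a x y /=; rewrite linA linB.
  exists (L * K) => [|x /=]; first exact: mulr_ge0.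
  by apply: le_trans (hL _) _; rewrite -mulrA ler_wpM2l.
have posT : positive_operator (adjoint A \o A).
  by move=> x /=; rewrite adjA inner_norm exprn_ge0.
have [bS posS] : [set S | [/\ bounded_operator S, positive_operator S &
    S \o S = adjoint A \o A]] (op_abs A).
  by apply: getPex; exact: positive_sqrt.
move=> sqS; split=> // x.
have linS := ((bounded_operatorP _).1 bS).1.
apply/eqP; rewrite -(@eqrXn2 _ 2) ?nrm_ge0 // -!rinner_nrm /rinner.
rewrite (positive_symmetric linS posS).
have -> : op_abs A (op_abs A x) = adjoint A (A x) by have := congr1 (@^~ x) sqS.
by rewrite -adjointP.
Qed.

End FunctionalCalculus.

(** * McCarthy's inequality and Berezin radii *)

Section McCarthy.
Variables (R : realType) (H : hilbertType R).
Implicit Types (x y : H) (T : H -> H).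

(** For [c > 0] this is the tangent at [u = c^2] of [u^(p/2)], which is convex
    because [p/2 >= 1]. *)
Lemma powR_tangent_sq (p c : R) : 2 <= p -> 0 <= c -> exists L : R,
  forall s, 0 <= s -> c `^ p + L * (s ^+ 2 - c ^+ 2) <= s `^ p.
Proof.
move=> p2; have sqE u : 0 <= u -> (u ^+ 2) `^ (p / 2) = u `^ p.
  by move=> u0; rewrite -powR_mulrn // -powRrM mulrC divfK.
rewrite le_eqVlt => /predU1P[<-|c0].
  by exists 0 => s _; rewrite mul0r addr0 powR0 ?powR_ge0 // gt_eqF //; lra.
exists (p / 2 * (c ^+ 2) `^ (p / 2 - 1)) => s s0.
rewrite -!sqE //; last exact: ltW.
by apply: powR_tangent; rewrite ?sqr_ge0 ?exprn_gt0 //; lra.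
Qed.

(** With [c = |T y|], the function [s^p] lies above a parabola that takes the
    value [c^p] at [c], and the quadratic form of that parabola at [y] is
    [c^p] exactly. *)
Lemma mccarthy T (p : R) y : bounded_operator T -> positive_operator T ->
  2 <= p -> nrm y = 1 -> nrm (T y) `^ p <= rinner (op_pow T p y) y.
Proof.
move=> bT posT p2 y1.
have [linT [K K0 hK]] := (bounded_operatorP _).1 bT.
have symT := positive_symmetric linT posT.
have T_ge0 := positive_rinner_ge0 posT.
have hf : quadratic_modulus (fun s : R => s `^ p).
  by apply: quadratic_modulus_powR; lra.
have [_ hS] := op_funP hf bT posT.
have [L hL] := powR_tangent_sq p2 (nrm_ge0 (T y)).
set c := nrm (T y) in hL *.
rewrite -subr_le0; apply: (@le0_natSinv _ _ 2) => n.
have e0 : 0 < n.+1%:R^-1 :> R by rewrite invr_gt0.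
have [q hq] := weierstrass K hf e0.
have := hS _ _ _ hK hq y; rewrite -/(op_pow T p) y1 mulr1 => hqS.
have := rinner_le (op_poly q T y - op_pow T p y) y.
rewrite y1 mulr1 rinnerBl.
have /(_ y) : poly_positive T
    (q + (n.+1%:R^-1 - c `^ p + L * c ^+ 2)%:P - L *: ('X * 'X)).
  apply: (poly_positiveP linT symT T_ge0 hK K0) => s hs.
  have := hq s hs; rewrite !(hornerD, hornerN, hornerZ, hornerM, hornerC, hornerX) ler_norml => /andP[+ _].
  case/andP: hs => s0 _; have := hL s s0.
  by move: (n.+1%:R^-1) => e; lra.
rewrite op_polyD op_polyN // op_polyZ // op_polyD op_polyMX op_polyX // op_polyC.
rewrite rinnerBl rinnerDl !rinnerZl rinner_nrm y1 expr1n mulr1.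
rewrite [rinner (T (T y)) y]/rinner symT -/(rinner _ _) rinner_nrm -/c.
by move: hqS; move: (n.+1%:R^-1) => e; lra.
Qed.

End McCarthy.

Section Berezin.
Variables (R : realType) (Omega : Type) (H : rkhsType R Omega).
Implicit Types (A P Q : H -> H) (lam mu : Omega) (s t p : R).

Lemma sup_powR_le (E : set R) p b : E !=set0 -> 0 < p ->
  (forall x, E x -> 0 <= x /\ x `^ p <= b) -> sup E `^ p <= b.
Proof.
move=> [x0 Ex0] p0 hE.
have b0 : 0 <= b by apply: le_trans (powR_ge0 x0 p) (hE _ Ex0).2.
have ubE : ubound E (b `^ p^-1).
  move=> x /hE[x_ge0 xb].
  have -> : x = (x `^ p) `^ p^-1 by rewrite -powRrM divff ?powRr1 // gt_eqF.
  by apply: ge0_ler_powR; rewrite ?nnegrE ?powR_ge0 ?invr_ge0 // ltW.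
have sup0 : 0 <= sup E.
  by apply: le_trans (hE _ Ex0).1 _; apply: ub_le_sup => //; exists (b `^ p^-1).
have -> : b = (b `^ p^-1) `^ p by rewrite -powRrM mulVf ?powRr1 // gt_eqF.
apply: ge0_ler_powR; rewrite ?nnegrE ?powR_ge0 ?(ltW p0) //.
by apply: ge_sup => //; exists x0.
Qed.

Hypothesis hker : forall lam : Omega, rkernel H lam != 0.

Lemma nrm_nkernel lam : nrm (nkernel H lam) = 1.
Proof.
rewrite /nkernel nrmZ nrmE ComplexField.Normc.normcV normc_real.
by rewrite ger0_norm ?nrm_ge0 // mulVf // nrm_eq0.
Qed.

Lemma berezin_abs_ge0 A lam mu : 0 <= berezin_abs A lam mu.
Proof. exact: normc_ge0. Qed.

Lemma berezin_abs_le_nrm A lam mu : berezin_abs A lam mu <= nrm (A (nkernel H lam)).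
Proof. by apply: le_trans (normc_inner_le _ _) _; rewrite nrm_nkernel mulr1. Qed.

Lemma berezin_abs_adjoint A lam mu : bounded_operator A ->
  berezin_abs A lam mu = berezin_abs (adjoint A) mu lam.
Proof.
move=> bA; rewrite /berezin_abs adjointP // inner_conj.
by case: (inner _ _) => a b /=; rewrite sqrrN.
Qed.

Lemma berezin_abs_le_ber A lam : bounded_operator A -> berezin_abs A lam lam <= ber A.
Proof.
move=> /bounded_operatorP[_ [K K0 hK]]; apply: ub_le_sup; last by exists lam.
exists K => _ [mu _ <-]; apply: le_trans (berezin_abs_le_nrm _ _ _) _.
by have := hK (nkernel H mu); rewrite nrm_nkernel mulr1.
Qed.

Lemma bounded_combination P Q s t : bounded_operator P -> bounded_operator Q ->
  bounded_operator (s%:C *: P + t%:C *: Q).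
Proof.
move=> /bounded_operatorP[lP [K K0 hK]] /bounded_operatorP[lQ [L L0 hL]].
apply/bounded_operatorP; split.
  move=> a x y; rewrite !fctE lP lQ !scalerDr !scalerA ![_%:C * a]mulrC.
  by rewrite addrACA.
exists (`|s| * K + `|t| * L) => [|x]; first by rewrite addr_ge0 ?mulr_ge0.
rewrite !fctE; apply: le_trans (ler_nrmD _ _) _; rewrite !nrmZr mulrDl -!mulrA.
by apply: lerD; apply: ler_wpM2l.
Qed.

Lemma le_ber_combination P Q s lam : bounded_operator P -> bounded_operator Q ->
  s * rinner (P (nkernel H lam)) (nkernel H lam)
  + (1 - s) * rinner (Q (nkernel H lam)) (nkernel H lam)
  <= ber (s%:C *: P + (1 - s)%:C *: Q).
Proof.
move=> bP bQ; apply: le_trans (berezin_abs_le_ber lam (bounded_combination _ _ bP bQ)).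
apply: le_trans (Re_le_normc _); rewrite -/(rinner _ _) !fctE.
by rewrite rinnerDl !rinnerZl.
Qed.

Hypothesis hOmega : [set: Omega] !=set0.

(** The Berezin radius of the segment from [Q] to [P] is a Lipschitz function
    of its parameter. *)
Lemma ber_combination_lipschitz P Q : bounded_operator P -> bounded_operator Q ->
  exists2 K : R, 0 <= K & forall s t,
    ber (s%:C *: P + (1 - s)%:C *: Q) <=
    ber (t%:C *: P + (1 - t)%:C *: Q) + K * `|s - t|.
Proof.
move=> bP bQ; have [_ [K K0 hK]] := (bounded_operatorP _).1 bP.
have [_ [L L0 hL]] := (bounded_operatorP _).1 bQ.
exists (K + L) => [|s t]; first exact: addr_ge0.
apply: ge_sup; first by have [lam _] := hOmega; exists (berezin_abs (s%:C *: P + (1 - s)%:C *: Q) lam lam), lam.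
move=> _ [lam _ <-].
apply: le_trans (lerD (berezin_abs_le_ber lam (bounded_combination t (1 - t) bP bQ)) (lexx _)).
rewrite /berezin_abs; set k := nkernel H lam.
have k1 : nrm k = 1 by exact: nrm_nkernel.
have -> : (s%:C *: P + (1 - s)%:C *: Q) k =
    (t%:C *: P + (1 - t)%:C *: Q) k + (s - t)%:C *: (P k - Q k).
  rewrite !fctE scalerBr addrACA -scalerDl -scalerBl -!rmorphD -rmorphB /=.
  by congr (_%:C *: _ + _%:C *: _); ring.
rewrite innerDl; apply: le_trans (le_normcD _ _) _; rewrite lerD2l.
apply: le_trans (normc_inner_le _ _) _; rewrite k1 mulr1 nrmZr mulrC.
apply: ler_wpM2r => //; apply: le_trans (ler_nrmD _ _) _; rewrite nrmN.
by have := hK k; have := hL k; rewrite k1; lra.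
Qed.

Lemma ber_combination_min P Q : bounded_operator P -> bounded_operator Q ->
  exists2 c, 0 <= c <= 1 & forall s, 0 <= s <= 1 ->
    ber (c%:C *: P + (1 - c)%:C *: Q) <= ber (s%:C *: P + (1 - s)%:C *: Q).
Proof.
move=> bP bQ; have [K K0 hK] := ber_combination_lipschitz bP bQ.
pose g s := ber (s%:C *: P + (1 - s)%:C *: Q).
have cg : continuous g.
  move=> s; apply/cvgrPdist_lt => e e0.
  have K1 : 0 < K + 1 by lra.
  apply/nbhs_ballP; exists (e / (K + 1)) => /=; first exact: divr_gt0.
  move=> t; rewrite /ball /= ltr_pdivlMr // => st.
  have := hK s t; have := hK t s; rewrite -/(g s) -/(g t) (distrC t s).
  by have := normr_ge0 (s - t); rewrite ltr_norml; nra.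
have [c c01 hc] := EVT_min ler01 (continuous_subspaceT cg).
exists c; first by move: c01; rewrite in_itv.
by move=> s hs; apply: hc; rewrite in_itv.
Qed.

(** McCarthy's inequality at the unit vector [k] gives
    [|A k|^p = | |A| k |^p <= < |A|^p k, k>]. *)
Lemma nrm_powR_le_op_abs A p lam : bounded_operator A -> 2 <= p ->
  nrm (A (nkernel H lam)) `^ p <=
  rinner (op_pow (op_abs A) p (nkernel H lam)) (nkernel H lam).
Proof.
move=> bA p2; have [bS posS <-] := op_absP bA.
by apply: mccarthy => //; exact: nrm_nkernel.
Qed.

Lemma bounded_op_pow_abs A p : bounded_operator A -> 2 <= p ->
  bounded_operator (op_pow (op_abs A) p).
Proof.
move=> bA p2; have [bS posS _] := op_absP bA.
by have [] := op_funP (quadratic_modulus_powR (_ : 1 <= p)) bS posS; first lra.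
Qed.

Lemma powR_berezin_abs_le A p lam mu : 0 <= p ->
  berezin_abs A lam mu `^ p <= nrm (A (nkernel H lam)) `^ p.
Proof.
by move=> p0; apply: ge0_ler_powR; rewrite ?nnegrE ?nrm_ge0 ?berezin_abs_ge0 ?berezin_abs_le_nrm.
Qed.

End Berezin.

Theorem theorem3p4 (R : realType) (Omega : Type) (hOmega : [set: Omega] !=set0)
    (H : rkhsType R Omega) (hker : forall lam : Omega, rkernel H lam != 0)
    (sigma : R -> R -> R) (sigma_ : R -> R -> R -> R)
    (hsigma : symmetric_mean sigma) (hpath : interpolation_path sigma sigma_)
    (A : H -> H) (hA : bounded_operator A)
    (t : R) (ht : 0 <= t <= 1) (hle : mean_le (sigma_ t) (nabla t))
    (p : R) (hp : 2 <= p) :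
  ber_norm (sigma_ t) p A `^ p <=
    ber (t%:C *: op_pow (op_abs (adjoint A)) p
         + (1 - t)%:C *: op_pow (op_abs A) p)
  /\
  exists2 m : R,
    (let E := [set ber (s%:C *: op_pow (op_abs A) p
                        + (1 - s)%:C *: op_pow (op_abs (adjoint A)) p)
              | s in [set s : R | 0 <= s <= 1]] in
     E m /\ lbound E m) &
    ber A `^ p <= m.
Proof.
have bA' := adjoint_bounded hA.
have p0 : 0 < p by lra.
have bP := bounded_op_pow_abs hA hp; have bP' := bounded_op_pow_abs bA' hp.
split.
  apply: sup_powR_le => // [|_ [[lam mu] _ <-] /=].
    by have [lam _] := hOmega; eexists; exists (lam, lam).
  split; first exact: powR_ge0.
  set a := berezin_abs A lam mu `^ p; set b := berezin_abs _ lam mu `^ p.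
  have a0 : 0 <= a by exact: powR_ge0. have b0 : 0 <= b by exact: powR_ge0.
  have m0 : 0 <= sigma_ t a b := mean_ge0 (path_mean hpath ht) a0 b0.
  rewrite -powRrM mulVf ?gt_eqF // powRr1 //.
  apply: le_trans (hle _ _ a0 b0) (le_trans _ (le_ber_combination hker t mu bP' bP)).
  have /andP[t0 t1] := ht; rewrite /nabla; apply: lerD; apply: ler_wpM2l; rewrite ?subr_ge0 //.
    apply: le_trans (nrm_powR_le_op_abs hker mu bA' hp).
    rewrite /a berezin_abs_adjoint //; exact: powR_berezin_abs_le (ltW p0).
  apply: le_trans (nrm_powR_le_op_abs hker mu hA hp).
  have -> : b = berezin_abs (adjoint (adjoint A)) mu lam `^ p.
    by rewrite /b (berezin_abs_adjoint _ _ bA').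
  by rewrite -(nrm_adjointK _ hA); exact: powR_berezin_abs_le (ltW p0).
have [c c01 hc] := ber_combination_min hker hOmega bP bP'.
exists (ber (c%:C *: op_pow (op_abs A) p
             + (1 - c)%:C *: op_pow (op_abs (adjoint A)) p)).
  by split; [exists c|move=> _ [s hs <-]; exact: hc].
apply: sup_powR_le => // [|_ [lam _ <-]].
  by have [lam _] := hOmega; exists (berezin_abs A lam lam), lam.
split; first exact: berezin_abs_ge0.
apply: le_trans (le_ber_combination hker c lam bP bP').
have /andP[c0 c1] := c01.
have -> : berezin_abs A lam lam `^ p = c * berezin_abs A lam lam `^ p
    + (1 - c) * berezin_abs (adjoint A) lam lam `^ p.
  by rewrite -berezin_abs_adjoint // -mulrDl subrKC mul1r.
apply: lerD; apply: ler_wpM2l; rewrite ?subr_ge0 //.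
  by apply: le_trans (nrm_powR_le_op_abs hker lam hA hp); exact: powR_berezin_abs_le (ltW p0).
by apply: le_trans (nrm_powR_le_op_abs hker lam bA' hp); exact: powR_berezin_abs_le (ltW p0).
Qed.
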